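(* Let $m\ge 2$ be an integer, let $\varphi$ denote Euler's totient function, and let $\alpha,\beta$ be the functions on $\{1,2,3,6\}$ defined by $$\alpha(1)=1,\ \alpha(2)=3,\ \alpha(3)=2,\ \alpha(6)=4,\qquad \beta(1)=0,\ \beta(2)=2,\ \beta(3)=2,\ \beta(6)=4.$$ Then $|\mathrm{GL}(2,\mathbb{Z}_2)\backslash\Lambda(m)/\mathfrak{D}_m|$ is equal to $$\frac{1}{2m}\Bigl[\sum_{d\mid m}\Bigl\{\varphi(m/d)\cdot\frac{1}{6}\Bigl(\alpha\bigl((m/d,6)\bigr)A(d)+\beta\bigl((m/d,6)\bigr)A(d-1)\Bigr)\Bigr\}+E(m)\Bigr],$$ where $(m/d,6)$ denotes the greatest common divisor of $m/d$ and $6$, $A(q)=2^q+(-1)^q\,2$ for integers $q\ge 0$, and $$E(m)=\begin{cases}\frac{m}{6}A\bigl(\frac{m+1}{2}\bigr)&\text{if } m \text{ is odd},\\ m\cdot 2^{m/2-1}&\text{if } m\text{ is even}.\end{cases}$$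
   Context: For an integer $m\ge 2$, $S(m)$ is the unit circle in $\mathbb{C}$ with the $m$ vertices $e^{2\pi i k/m}$ $(k=0,1,\dots,m-1)$, which divide it into $m$ arcs. A coloring on $S(m)$ is an assignment of one of three fixed colors, taken to be the three nonzero elements of $(\mathbb{Z}_2)^2$ (with $\mathbb{Z}_2=\mathbb{Z}/2\mathbb{Z}$), to each arc such that any two adjacent arcs (arcs sharing a vertex) have different colors. $\Lambda(m)$ is the set of all colorings on $S(m)$. $\mathfrak{D}_m$ is the dihedral group of order $2m$ consisting of the $m$ rotations of $\mathbb{C}$ by angles $2\pi k/m$ and the $m$ reflections in the lines obtained by rotating the real axis by angles $\pi k/m$ $(k=0,\dots,m-1)$. It preserves the vertices of $S(m)$ and hence acts on the arcs and on $\Lambda(m)$. $\mathrm{GL}(2,\mathbb{Z}_2)$ acts on $\Lambda(m)$ by composition, $\lambda\mapsto\sigma\circ\lambda$, i.e. by permuting the three colors. These two actions commute, and $\mathrm{GL}(2,\mathbb{Z}_2)\backslash\Lambda(m)/\mathfrak{D}_m$ is the set of orbits (double coset) under both. *)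

(* Defs.v *)
From HB Require Import structures.
From mathcomp Require Import all_boot all_order all_algebra all_fingroup.
From mathcomp Require Import boolp classical_sets reals trigo complex.

Set Implicit Arguments.
Unset Strict Implicit.
Unset Printing Implicit Defensive.

Import GRing.Theory Num.Theory.
Local Open Scope ring_scope.

Section Circle.
Context {R : realType}.

(* e^{it}; the complex numbers are R[i] with R a model of the reals. *)
Definition cis (t : R) : R[i] := Complex (cos t) (sin t).

Definition vertex (m k : nat) : R[i] := cis (2 * pi * k%:R / m%:R).

(* The closed arc running counterclockwise from vertex k to vertex k + 1.
   The m arcs of S(m) are the [arc i] for i : 'I_m. *)
Definition arc (m k : nat) : set R[i] :=
  [set z | exists2 t : R,
     2 * pi * k%:R / m%:R <= t <= 2 * pi * k.+1%:R / m%:R & z = cis t]%classic.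

Definition rotation (t : R) (z : R[i]) : R[i] := cis t * z.

(* Reflection in the real axis rotated by the angle t. *)
Definition reflection (t : R) (z : R[i]) : R[i] :=
  rotation t (conjc (rotation (- t) z)).

Definition dihedral (m : nat) : set (R[i] -> R[i]) :=
  [set g | exists k : 'I_m, g = rotation (2 * pi * k%:R / m%:R)
                         \/ g = reflection (pi * k%:R / m%:R)]%classic.

End Circle.

Definition adjacent (R : realType) (m : nat) (i j : 'I_m) : Prop :=
  i <> j /\ exists k : 'I_m, @arc R m i (vertex m k) /\ @arc R m j (vertex m k).

(* A coloring is recorded as the function sending i to the color of [arc i];
   the colors are the nonzero vectors of (Z/2)^2. *)
Definition colorings (R : realType) (m : nat) : {set {ffun 'I_m -> 'cV['F_2]_2}} :=
  [set l : {ffun _} | `[< (forall i, l i <> 0) /\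
               (forall i j, adjacent R i j -> l i <> l j) >]].

(* The permutations of the arcs induced by the elements of the dihedral group.
   For m = 2, distinct elements may induce the same permutation; this does not
   affect the orbits. *)
Definition arc_perms (R : realType) (m : nat) : {set 'S_m} :=
  [set s : 'S_m | `[< exists2 g, @dihedral R m g &
     forall i : 'I_m, (g @` arc m i)%classic = arc m (s i) >]].

(* sigma o l o s *)
Definition act (m : nat) (sigma : {'GL_2['F_2]}) (s : 'S_m)
    (l : {ffun 'I_m -> 'cV['F_2]_2}) : {ffun 'I_m -> 'cV['F_2]_2} :=
  [ffun i => GLval sigma *m l (s i)].

Definition double_orbit (R : realType) (m : nat) (l : {ffun 'I_m -> 'cV['F_2]_2}) :
    {set {ffun 'I_m -> 'cV['F_2]_2}} :=
  [set act sigma s l | sigma : {'GL_2['F_2]}, s : 'S_m in arc_perms R m].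

(* GL(2,Z_2) \ Lambda(m) / D_m *)
Definition double_coset (R : realType) (m : nat) :
    {set {set {ffun 'I_m -> 'cV['F_2]_2}}} :=
  [set double_orbit R l | l in colorings R m].

(* alpha and beta are only ever used on {1, 2, 3, 6}. *)
Definition alpha (n : nat) : rat :=
  match n with 1%N => 1 | 2%N => 3 | 3%N => 2 | 6%N => 4 | _ => 0 end.

Definition beta (n : nat) : rat :=
  match n with 1%N => 0 | 2%N => 2 | 3%N => 2 | 6%N => 4 | _ => 0 end.

Definition A (q : nat) : rat := 2 ^+ q + (-1) ^+ q * 2.

Definition E (m : nat) : rat :=
  if odd m then m%:R / 6 * A (m.+1 %/ 2) else m%:R * 2 ^+ (m %/ 2 - 1).

(* Main.v *)
(* Burnside's lemma for the commuting actions of GL(2, Z_2) and of the 2m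
   rotations and reflections i |-> k + i, i |-> k - i of the arcs, indexed by
   Z/m (for m = 2 every induced permutation arises twice, which cancels out).
   A coloring fixed by (a, i |-> k + i), with d = gcd(k, m), exists only if
   a^(m/d) = 1, and is then determined by a path of d colors closing up under
   a power of a.  A coloring fixed by (a, i |-> k - i) exists only if a^2 = 1,
   and is determined by the colors of half of the circle, with a condition at
   both ends according to whether the axis crosses an arc or a vertex there.
   Both kinds of paths are counted by the powers of the adjacency matrix of the
   triangle, and the sums over a follow since GL(2, Z_2) acts on the colors as
   the symmetric group S_3. *)

Require Import Defs.
From mathcomp Require Import boolp classical_sets.
From mathcomp Require Import all_boot all_order all_algebra all_fingroup.
From mathcomp Require Import cyclic reals trigo complex.
From mathcomp Require Import ring lra zify.

Set Implicit Arguments.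
Unset Strict Implicit.
Unset Printing Implicit Defensive.

Import Order.TTheory GRing.Theory Num.Theory.
(* Re-imported because [seq] also exports an [arc]. *)
Import Defs.
Local Open Scope ring_scope.

(** * Arcs of the circle *)

Section Geometry.
Variable R : realType.
Implicit Types t u : R.

Lemma cisD t u : cis (t + u) = cis t * cis u.
Proof. by rewrite /cis cosD sinD; congr Complex; rewrite // addrC mulrC. Qed.

Lemma conjc_cis t : conjc (cis t) = cis (- t).
Proof. by rewrite /cis cosN sinN. Qed.

Lemma cisD2pi t : cis (t + 2 * pi) = cis t.
Proof. by rewrite /cis mulr_natl cosD2pi sinD2pi. Qed.

(** Here cos (t - u) = 1, so the half-angle formula gives sin ((t - u) / 2) = 0; the half angle lies
    strictly between -pi and pi, where sin vanishes only at 0. *)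
Lemma cis_inj t u : - (2 * pi) < t - u < 2 * pi -> cis t = cis u -> t = u.
Proof.
move=> tu [ct st].
have c1 : cos (t - u) = 1.
  by rewrite cosB ct st -!expr2 cos2Dsin2.
have s0 : sin ((t - u) / 2) = 0.
  apply/eqP; rewrite -sqrf_eq0; apply/eqP.
  have := cos_mulr2n ((t - u) / 2).
  have -> : ((t - u) / 2) *+ 2 = t - u by field.
  by rewrite c1 cos2sin2 => ?; lra.
have [h|h|/eqP] := ltgtP (t - u) 0; last by rewrite subr_eq0 => /eqP.
- have /sin_gt0_pi : 0 < - ((t - u) / 2) < pi by lra.
  by rewrite sinN s0 oppr0 ltxx.
- have /sin_gt0_pi : 0 < (t - u) / 2 < pi by lra.
  by rewrite s0 ltxx.
Qed.

Variable m : nat.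
Hypothesis m_gt0 : (0 < m)%N.

(** Angles measured in arcs: vertex [k] sits at [k], [arc m i] is the image of [i, i + 1], and a
    full turn is [m]. Statements about arcs then become linear inequalities. *)
Let ang (x : R) : R := 2 * pi * x / m%:R.

Let m_pos : (0 : R) < m%:R. Proof. by rewrite ltr0n. Qed.

Let natS (j : nat) : j.+1%:R = j%:R + 1 :> R.
Proof. by rewrite natr1. Qed.

Let angE x : ang x = x * (2 * pi / m%:R).
Proof. by rewrite /ang; ring. Qed.

Let unit_gt0 : (0 : R) < 2 * pi / m%:R.
Proof. by rewrite divr_gt0 // mulr_gt0 // pi_gt0. Qed.

Let ler_ang x y : (ang x <= ang y) = (x <= y).
Proof. by rewrite !angE ler_pM2r. Qed.

Let ltr_ang x y : (ang x < ang y) = (x < y).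
Proof. by rewrite !angE ltr_pM2r. Qed.

Let angD x y : ang (x + y) = ang x + ang y.
Proof. by rewrite !angE mulrDl. Qed.

Let angN x : ang (- x) = - ang x.
Proof. by rewrite !angE mulNr. Qed.

Let angm : ang m%:R = 2 * pi.
Proof. by rewrite /ang; field; rewrite gt_eqF. Qed.

Let ang_surj t : exists x, t = ang x.
Proof.
exists (t / (2 * pi / m%:R)).
by rewrite angE divfK // gt_eqF.
Qed.

Lemma arcP (i : nat) (z : R[i]) :
  arc m i z <-> exists2 x : R, i%:R <= x <= i.+1%:R & z = cis (ang x).
Proof.
split=> [[t ht ->]|[x hx ->]]; last by exists (ang x) => //; rewrite !ler_ang.
have [x tx] := ang_surj t; exists x; last by rewrite tx.
by move: ht; rewrite tx !ler_ang.
Qed.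

Let cis_ang_inj x y : - m%:R < x - y < m%:R -> cis (ang x) = cis (ang y) -> x = y.
Proof.
move=> h /cis_inj; rewrite -angm -!angN -!angD !ltr_ang => /(_ h) /eqP.
by rewrite eq_le !ler_ang -eq_le => /eqP.
Qed.

Let cis_ang_m x : cis (ang (x + m%:R)) = cis (ang x).
Proof. by rewrite angD angm cisD2pi. Qed.

Lemma arcDm (i : nat) : arc m (i + m) = arc m i :> set R[i].
Proof.
apply/seteqP; split=> z /arcP [x hx ->]; apply/arcP.
- exists (x - m%:R); last by rewrite -[in LHS](subrK m%:R x) cis_ang_m.
  by move: hx; rewrite -addSn !natrD; lra.
- exists (x + m%:R); last by rewrite cis_ang_m.
  by move: hx; rewrite -addSn !natrD; lra.
Qed.

Lemma arc_mod (i : nat) : arc m (i %% m) = arc m i :> set R[i].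
Proof.
rewrite {2}(divn_eq i m); elim: (i %/ m)%N => [|q IH]; first by rewrite mul0n.
by rewrite mulSn -addnA addnC arcDm.
Qed.

(** The midpoint i + 1/2 of an arc lies on no other arc. *)
Lemma arc_inj (i j : 'I_m) : arc m i = arc m j :> set R[i] -> i = j.
Proof.
move=> eij.
have : (arc m i : set R[i]) (cis (ang (i%:R + 2^-1))).
  by apply/arcP; exists (i%:R + 2^-1) => //; rewrite (natS i); lra.
rewrite eij => /arcP [x hx e].
have him : (i.+1)%:R <= m%:R :> R by rewrite ler_nat.
have hjm : (j.+1)%:R <= m%:R :> R by rewrite ler_nat.
have hi0 : 0 <= i%:R :> R by [].
have hj0 : 0 <= j%:R :> R by [].
have ex : i%:R + 2^-1 = x.
  apply: cis_ang_inj => //.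
  by move: hx him hjm; rewrite ?(natS i) ?(natS j) ?(natS k); lra.
rewrite -ex in hx.
have : (i < j.+1)%N && (j < i.+1)%N.
  rewrite -!(ltr_nat R).
  by move: hx; rewrite ?(natS i) ?(natS j) ?(natS k); lra.
by move=> ?; apply: val_inj => /=; lia.
Qed.

Lemma vertex_arc (i k : 'I_m) :
  (arc m i : set R[i]) (vertex m k) <-> (k = i :> nat) \/ (k = i.+1 %% m :> nat)%N.
Proof.
have him : (i.+1)%:R <= m%:R :> R by rewrite ler_nat.
have hkm : (k.+1)%:R <= m%:R :> R by rewrite ler_nat.
have hi0 : 0 <= i%:R :> R by [].
have hk0 : 0 <= k%:R :> R by [].
split.
- case/arcP=> x hx e.
  (* Both coordinates lie in [0, m], so the only coincidence not covered by injectivity is x = m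
     with k = 0, at the end of the last arc. *)
  have [xk|xk] := ltP (x - k%:R) m%:R.
    have ex : k%:R = x.
      apply: cis_ang_inj; last exact: e.
      by move: hx him hkm xk; rewrite ?(natS i) ?(natS j) ?(natS k); lra.
    move: hx; rewrite -ex !ler_nat => /andP[h1 h2].
    have [->|nki] := eqVneq (k : nat) i; first by left.
    right; have ek : (k = i.+1 :> nat) by apply/eqP; rewrite eqn_leq h2 ltn_neqAle eq_sym nki.
    by rewrite -ek modn_small.
  right.
  have : (k <= 0)%N by rewrite -(ler_nat R); move: hx him xk; rewrite ?(natS i) ?(natS j) ?(natS k); lra.
  rewrite leqn0 => /eqP ->.
  have : (m <= i.+1)%N by rewrite -(ler_nat R); move: hx him xk; rewrite ?(natS i) ?(natS j) ?(natS k); lra.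
  move=> h; have -> : i.+1 = m by apply/eqP; rewrite eqn_leq h ltn_ord.
  by rewrite modnn.
- case=> e; apply/arcP.
    by exists i%:R; [rewrite lexx ler_nat leqnSn | rewrite /vertex e].
  exists i.+1%:R; first by rewrite lexx ler_nat leqnSn.
  rewrite /vertex e.
  have : (i.+1 <= m)%N by [].
  rewrite leq_eqVlt => /orP[/eqP ->|h]; last by rewrite modn_small.
  by rewrite modnn -/(ang _) -[m%:R in RHS]add0r cis_ang_m.
Qed.

Lemma rotation_arc (k i : nat) :
  (rotation (2 * pi * k%:R / m%:R) @` arc m i)%classic = arc m (k + i) :> set R[i].
Proof.
apply/seteqP; split=> z.
- case=> w /arcP [x hx ->] <-; apply/arcP; exists (k%:R + x).
    by rewrite -addnS !natrD; lra.
  by rewrite angD cisD.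
- case/arcP=> x hx ->; exists (cis (ang (x - k%:R))).
    by apply/arcP; exists (x - k%:R) => //; move: hx; rewrite -addnS !natrD; lra.
  by rewrite /rotation -cisD -/(ang _) -angD addrC subrK.
Qed.

(** In units of arcs the reflection is x |-> k - x, which sends [i, i + 1] to [k - i - 1, k - i].
    Adding [m] keeps the index a natural number. *)
Lemma reflection_arc (k i : nat) : (i < m)%N ->
  (reflection (pi * k%:R / m%:R) @` arc m i)%classic =
  arc m (k + (m.-1 - i)) :> set R[i].
Proof.
move=> im.
have reflE x : reflection (pi * k%:R / m%:R) (cis (ang x)) = cis (ang (k%:R - x)).
  rewrite /reflection /rotation -cisD conjc_cis -cisD; congr cis.
  by rewrite /ang; field; rewrite gt_eqF.
have e1 : (k + (m.-1 - i))%:R = k%:R + m%:R - i.+1%:R :> R.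
  rewrite -natrD -natrB; last by lia.
  by congr _%:R; lia.
have e2 : (k + (m.-1 - i)).+1%:R = k%:R + m%:R - i%:R :> R.
  by rewrite -addn1 natrD e1 (natS i); ring.
apply/seteqP; split=> z.
- case=> w /arcP [x hx ->] <-; apply/arcP; exists (k%:R - x + m%:R).
    by rewrite e1 e2; lra.
  by rewrite reflE cis_ang_m.
- case/arcP=> x hx ->; exists (cis (ang (k%:R + m%:R - x))).
    by apply/arcP; exists (k%:R + m%:R - x) => //; move: hx; rewrite e1 e2; lra.
  rewrite reflE.
  by rewrite -[in RHS](subrK m%:R x) cis_ang_m; congr (cis (ang _)); ring.
Qed.

End Geometry.

(** * The action of GL(2, Z_2) on the colors *)

Section Colors.
Local Notation GL2 := {'GL_2['F_2]}.
Local Notation V := 'cV['F_2]_2.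

Definition fixed_colors (a : GL2) : {set V} :=
  [set v | (v != 0) && (GLval a *m v == v)].

Let vec (x y : 'F_2) : V := \col_(i < 2) if i == ord0 then x else y.

Let vecE (v : V) : v = vec (v ord0 ord0) (v ord_max ord0).
Proof.
apply/matrixP => i j; rewrite !mxE ord1; case: (unliftP ord0 i) => [k ->|->] //.
by congr (v _ _); apply: val_inj; case: k => [[]].
Qed.

Let vec_bij : bijective (fun u => vec u.1 u.2).
Proof.
exists (fun v : V => (v ord0 ord0, v ord_max ord0)) => [[x y]|v] /=; first by rewrite !mxE.
by rewrite -vecE.
Qed.

Let card_vec (P : pred V) :
  #|[set v | P v]| = (\sum_(x : 'F_2) \sum_(y : 'F_2) P (vec x y))%N.
Proof.
rewrite -sum1dep_card big_mkcond /= (reindex _ (onW_bij _ vec_bij)) pair_big /=.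
by apply: eq_bigr => u _; case: (P _).
Qed.

Let vec_eq x y x' y' : (vec x y == vec x' y') = (x == x') && (y == y').
Proof.
apply/eqP/andP => [e|[/eqP -> /eqP ->]] //.
have h i j : vec x y i j = vec x' y' i j by rewrite e.
by have := h ord0 ord0; have := h ord_max ord0; rewrite !mxE /= => -> ->.
Qed.

Lemma card_colors : #|[set v : V | v != 0]| = 3%N.
Proof.
rewrite card_vec (_ : 0 = vec 0 0); last by rewrite [LHS]vecE !mxE.
under eq_bigr do under eq_bigr do rewrite vec_eq.
by rewrite !big_ord_recl !big_ord0.
Qed.

Let mat (a b c d : 'F_2) : 'M['F_2]_2 :=
  \matrix_(i < 2, j < 2)
    if i == ord0 then if j == ord0 then a else b else if j == ord0 then c else d.

Let matE (A : 'M['F_2]_2) :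
  A = mat (A ord0 ord0) (A ord0 ord_max) (A ord_max ord0) (A ord_max ord_max).
Proof.
apply/matrixP => i j; rewrite !mxE.
case: (unliftP ord0 i) => [i' ->|->]; case: (unliftP ord0 j) => [j' ->|->] //=;
 by congr (A _ _); apply: val_inj; do ?[case: i' => [[]]|case: j' => [[]]].
Qed.

Let mat_bij : bijective (fun u => mat u.1.1 u.1.2 u.2.1 u.2.2).
Proof.
exists (fun A : 'M['F_2]_2 =>
    ((A ord0 ord0, A ord0 ord_max), (A ord_max ord0, A ord_max ord_max))).
  by move=> [[a b] [c d]] /=; rewrite !mxE.
by move=> A /=; rewrite -matE.
Qed.

Let mat_eq a b c d a' b' c' d' :
  (mat a b c d == mat a' b' c' d') = [&& a == a', b == b', c == c' & d == d'].
Proof.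
apply/eqP/and4P => [e|[/eqP -> /eqP -> /eqP -> /eqP ->]] //.
have h i j : mat a b c d i j = mat a' b' c' d' i j by rewrite e.
by have := (h ord0 ord0, h ord0 ord_max, h ord_max ord0, h ord_max ord_max);
   rewrite !mxE /= => -[[[-> ->] ->] ->].
Qed.

Let mat_mul a b c d a' b' c' d' : mat a b c d *m mat a' b' c' d' =
  mat (a * a' + b * c') (a * b' + b * d') (c * a' + d * c') (c * b' + d * d').
Proof.
apply/matrixP => i j; rewrite !mxE !big_ord_recl big_ord0 !mxE /= addr0.
by do 2!case: ifP.
Qed.

Let mat_vec a b c d x y : mat a b c d *m vec x y = vec (a * x + b * y) (c * x + d * y).
Proof.
apply/matrixP => i j; rewrite !mxE !big_ord_recl big_ord0 !mxE /= addr0.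
by case: ifP.
Qed.

Let det_mat a b c d : \det (mat a b c d) = a * d - b * c.
Proof.
rewrite (expand_det_row _ ord0) !big_ord_recl big_ord0 /cofactor !det_mx11 !mxE /=.
by rewrite expr0 expr1 mul1r mulN1r mulrN addr0.
Qed.

Let fixed_mat (A : 'M['F_2]_2) := #|[set v : V | (v != 0) && (A *m v == v)]|.

(** Two explicit terms, so that sums over F_2 unfold by computation. *)
Let F2_sum (W : nmodType) (G : 'F_2 -> W) := G 0 + G 1.

Let F2_sumE (W : nmodType) (G : 'F_2 -> W) : \sum_x G x = F2_sum G.
Proof. by rewrite !big_ord_recl big_ord0 addr0; congr (_ + G _); exact: val_inj. Qed.

(** Evaluates the closed tests over F_2 first, then the closed counts of fixed vectors to which [f]
    is applied. *)
Ltac compute_F2 := cbv beta delta [F2_sum];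
  repeat match goal with
  | |- context [if ?b then _ else _] =>
    let v := eval vm_compute in b in change b with v; cbv iota
  end;
  repeat match goal with
  | |- context [?f (@GRing.add ?T ?u ?v)] =>
    match type of f with nat -> _ =>
    let w := eval vm_compute in (@GRing.add T u v) in
    change (@GRing.add T u v) with w end
  end.

Let fixed_matE a b c d : fixed_mat (mat a b c d) =
  (\sum_(x : 'F_2) \sum_(y : 'F_2)
    [&& ~~ ((x == 0) && (y == 0)), a * x + b * y == x & c * x + d * y == y]%R)%N.
Proof.
rewrite /fixed_mat card_vec (_ : 0 = vec 0 0); last by rewrite [LHS]vecE !mxE.
by do 2![apply: eq_bigr => ? _]; rewrite mat_vec !vec_eq.
Qed.

Let GL2_sum (F : 'M['F_2]_2 -> rat) : \sum_(a : GL2) F (GLval a) =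
  \sum_(a : 'F_2) \sum_(b : 'F_2) \sum_(c : 'F_2) \sum_(d : 'F_2)
    if a * d - b * c != 0 then F (mat a b c d) else 0.
Proof.
transitivity (\sum_(A : 'M['F_2]_2 | \det A != 0) F A).
  (* [insubd] inverts [GLval]; its default value 1 is taken only at singular matrices, which are
     outside the sum. *)
  rewrite (reindex_onto (fun a : GL2 => GLval a) (insubd (1%g : GL2))) /=.
    apply: eq_bigl => a; rewrite valKd eqxx andbT; apply/esym.
    have h : GLval a \in unitmx by exact: GL_unit.
    by rewrite unitmxE unitfE in h.
  by move=> A dA; rewrite insubdK // -topredE /= unitmxE unitfE.
pose G a b c d := if \det (mat a b c d) != 0 then F (mat a b c d) else 0.
rewrite big_mkcond (reindex _ (onW_bij _ mat_bij)) /=.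
rewrite -(pair_bigA _ (fun u v => G u.1 u.2 v.1 v.2)).
rewrite -(pair_bigA _ (fun a b => \sum_v G a b v.1 v.2)) /=.
do 2![apply: eq_bigr => ? _]; rewrite -(pair_bigA _ (G _ _)) /=.
by do 2![apply: eq_bigr => ? _]; rewrite /G det_mat.
Qed.

(** As permutations of the three colors, the identity fixes 3, the three transpositions fix 1 each
    and the two 3-cycles fix none. Since a^6 = 1, only gcd(g, 6) matters, and each of its four
    values is settled by enumerating matrices. *)
Lemma sum_fixed_colors (f : nat -> rat) g :
  \sum_(a : GL2 | (a ^+ g == 1)%g) f #|fixed_colors a| =
    f 3%N + (if (2 %| g)%N then 3 * f 1%N else 0) + (if (3 %| g)%N then 2 * f 0%N else 0).
Proof.
have e6 (a : GL2) : (a ^+ 6 = 1)%g.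
  have /order_dvdG : a \in [set: GL2] by rewrite inE.
  by rewrite card_GL_2 card_Fp // order_dvdn => /eqP.
(* [Q] is the entrywise form of the condition [P]; the right-hand side is a closed expression apart
   from [f]. *)
have sumE (P : pred 'M['F_2]_2) (Q : 'F_2 -> 'F_2 -> 'F_2 -> 'F_2 -> bool) :
    (forall a b c d, P (mat a b c d) = Q a b c d) ->
  \sum_(a : GL2 | P (GLval a)) f #|fixed_colors a| =
  F2_sum (fun a => F2_sum (fun b => F2_sum (fun c => F2_sum (fun d =>
    if a * d - b * c != 0 then if Q a b c d then
      f (F2_sum (fun x => F2_sum (fun y =>
        nat_of_bool [&& ~~ ((x == 0) && (y == 0)), a * x + b * y == x & c * x + d * y == y])))
    else 0 else 0)))).
  move=> PQ; rewrite big_mkcond.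
  rewrite [LHS](GL2_sum (fun A => if P A then f (fixed_mat A) else 0)).
  do 4![rewrite -[RHS]F2_sumE; apply: eq_bigr => ? _].
  rewrite PQ fixed_matE -F2_sumE.
  by under [in RHS]eq_bigr do rewrite -F2_sumE.
have mat1 : 1%:M = mat 1 0 0 1.
  by rewrite [LHS]matE !mxE.
have gcdE : (gcdn g 6 \in [:: 1; 2; 3; 6])%N.
  by have := dvdn_gcdr g 6; rewrite dvdn_divisors.
have -> : (2 %| g)%N = (2 %| gcdn g 6)%N by rewrite dvdn_gcd andbT.
have -> : (3 %| g)%N = (3 %| gcdn g 6)%N by rewrite dvdn_gcd andbT.
have condE (a : GL2) : (a ^+ g == 1)%g = (a ^+ gcdn g 6 == 1)%g.
  by rewrite -!order_dvdn dvdn_gcd [(_ %| 6)%N]order_dvdn e6 eqxx andbT.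
under eq_bigl do rewrite condE.
have valE (a b : GL2) : (a == b) = (GLval a == GLval b) by rewrite val_eqE.
move: gcdE; rewrite !inE => /or4P[] /eqP -> /=.
- under eq_bigl do rewrite valE.
  rewrite (sumE (fun A => A == 1%:M) (fun a b c d => [&& a == 1, b == 0, c == 0 & d == 1])).
    compute_F2.
    lra.
  by move=> a b c d; rewrite mat1 mat_eq.
- under eq_bigl do rewrite valE GL_MxE.
  rewrite (sumE (fun A => A *m A == 1%:M) (fun a b c d =>
    [&& a * a + b * c == 1, a * b + b * d == 0, c * a + d * c == 0 & c * b + d * d == 1])).
    compute_F2.
    lra.
  by move=> a b c d; rewrite mat1 mat_mul mat_eq.
- under eq_bigl do rewrite valE !GL_MxE.
  rewrite (sumE (fun A => A *m (A *m A) == 1%:M) (fun a b c d =>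
    let a' := a * a + b * c in let b' := a * b + b * d in
    let c' := c * a + d * c in let d' := c * b + d * d in
    [&& a * a' + b * c' == 1, a * b' + b * d' == 0, c * a' + d * c' == 0 & c * b' + d * d' == 1])).
    compute_F2.
    lra.
  by move=> a b c d; rewrite mat1 !mat_mul mat_eq.
- under eq_bigl do rewrite e6 eqxx.
  rewrite (sumE xpredT (fun _ _ _ _ => true)) //.
  compute_F2.
  lra.
Qed.

Local Notation "a *v x" := (GLval a *m x) (at level 40).
Local Notation D := [set v : V | v != 0].

Lemma GLvM (a b : GL2) (v : V) : (a * b)%g *v v = a *v (b *v v).
Proof. by rewrite GL_MxE mulmxA. Qed.

Lemma GLv1 (v : V) : (1%g : GL2) *v v = v.
Proof. by rewrite GL_1E mul1mx. Qed.

Lemma GLv_eq0 (a : GL2) (v : V) : (a *v v == 0) = (v == 0).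
Proof.
apply/eqP/eqP => [h|->]; last by rewrite mulmx0.
by rewrite -(mulKmx (GL_unit a) v) h mulmx0.
Qed.

Lemma GLv_inj (a : GL2) : injective (fun v : V => a *v v).
Proof. by move=> u v; exact: (can_inj (mulKmx (GL_unit a))). Qed.

(** The vectors u, v and u + v are all the nonzero ones, so [a] fixes every vector. *)
Lemma GL2_fix2 (a : GL2) (u v : V) : u != 0 -> v != 0 -> u != v ->
  a *v u = u -> a *v v = v -> a = 1%g.
Proof.
move=> u0 v0 uv au av.
have vv : v = - v.
  apply/eqP; rewrite -addr_eq0 -mulr2n -scaler_nat.
  by rewrite (_ : 2%:R = 0) ?scale0r //; apply: val_inj.
have uvD : [set u; v; u + v] = D.
  apply/eqP; rewrite eqEcard card_colors; apply/andP; split.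
    apply/subsetP => w; rewrite !inE => /orP[/orP[]|] /eqP -> //.
    by rewrite addr_eq0 -vv.
  rewrite setUC cardsU1 cards2 uv !inE -[X in _ == X]addr0 -[X in _ || (_ == X)]add0r.
  by rewrite (inj_eq (addrI u)) (inj_eq (addIr v)) (negPf u0) (negPf v0).
have aD (w : V) : a *v w = w.
  have [->|w0] := eqVneq w 0; first by rewrite mulmx0.
  have : w \in D by rewrite inE.
  by rewrite -uvD !inE => /orP[/orP[]|] /eqP ->; rewrite ?mulmxDr ?au ?av.
apply: val_inj => /=; apply/matrixP => i j.
have /(congr1 (fun w : V => w i ord0)) := aD (delta_mx j ord0).
by rewrite -colE !mxE eqxx andbT.
Qed.

End Colors.

(** * Walks on the triangle of colors *)

Section Walks.
Variables (T : finType) (x0 : T) (D : {set T}).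
Hypothesis card_D : #|D| = 3%N.

(** A walk with [r] steps on the complete graph on [D]; the relation [P] between its ends says how
    the walk closes up around the circle. *)
Definition walk r (P : rel T) (t : r.+1.-tuple T) :=
  [&& all (mem D) t, sorted (fun x y => x != y) t & P (nth x0 t 0) (nth x0 t r)].

Lemma sum_tuple_cons (M : nmodType) r (F : r.+1.-tuple T -> M) :
  \sum_(t : r.+1.-tuple T) F t = \sum_(c : T) \sum_(t : r.-tuple T) F [tuple of c :: t].
Proof.
rewrite pair_bigA /= (reindex (fun u : T * r.-tuple T => [tuple of u.1 :: u.2])) //.
exists (fun t : r.+1.-tuple T => (thead t, [tuple of behead t])) => [[c t] _|t _] /=.
  by rewrite theadE; congr pair; apply: val_inj.
by rewrite -tuple_eta.
Qed.

Lemma walk0 (P : rel T) c (t : 0.-tuple T) :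
  walk P [tuple of c :: t] = (c \in D) && P c c.
Proof. by rewrite tuple0 /walk /= andbT. Qed.

(** The first vertex is absorbed into the relation between the ends, which lets the count go by
    induction on [r] for all [P] at once. *)
Lemma walkS r (P : rel T) c (t : r.+1.-tuple T) :
  walk P [tuple of c :: t] = (c \in D) && walk (fun h e => (h != c) && P c e) t.
Proof.
case/tupleP: t => h t; rewrite /walk /= (eq_sym h).
by do ![case: (_ \in _) | case: (_ != _) | case: all | case: path].
Qed.

(* The entries of the r-th power of the adjacency matrix of the triangle are
   (2^r - (-1)^r)/3, plus (-1)^r on the diagonal. *)
Lemma card_walks r (P : rel T) :
  #|[set t : r.+1.-tuple T | walk P t]|%:R =
    (2 ^+ r - (-1) ^+ r) / 3 * (\sum_(c in D) \sum_(e in D) (P c e)%:R)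
    + (-1) ^+ r * \sum_(c in D) (P c c)%:R :> rat.
Proof.
have cardE n (Q : pred (n.-tuple T)) :
    #|[set t | Q t]|%:R = \sum_(t : n.-tuple T) (Q t)%:R :> rat.
  rewrite -sum1dep_card natr_sum big_mkcond /=; apply: eq_bigr => t _; by case: (Q t).
rewrite cardE; elim: r P => [|r IH] P; rewrite sum_tuple_cons.
  rewrite !expr0 subrr !mul0r add0r mul1r [RHS]big_mkcond; apply: eq_bigr => c _ /=.
  rewrite (big_pred1 [tuple]) => [|t]; last by apply/esym/eqP; exact: tuple0.
  by rewrite walk0; case: (c \in D).
under eq_bigr do under eq_bigr do rewrite walkS -mulnb natrM.
under eq_bigr do rewrite -big_distrr /= IH.
pose S c : rat := \sum_(e in D) (P c e)%:R.
have sub_c c (F : T -> rat) : c \in D ->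
    \sum_(h in D) (h != c)%:R * F h = (\sum_(h in D) F h) - F c.
  move=> cD; rewrite [in RHS](bigD1 c) //= addrAC subrr add0r.
  rewrite (bigD1 c) //= eqxx mul0r add0r.
  by apply: eq_bigr => h /andP[_ ->]; rewrite mul1r.
(* Prepending [c] removes the terms h = c. As [D] has three elements, the coefficients satisfy 2
   (2^r - (-1)^r)/3 + (-1)^r = (2^(r+1) - (-1)^(r+1))/3. *)
have stepE c : c \in D ->
   (2 ^+ r - (-1) ^+ r) / 3 *
     (\sum_(h in D) \sum_(e in D) ((h != c) && P c e)%:R) +
   (-1) ^+ r * \sum_(h in D) ((h != c) && P c h)%:R =
   (2 ^+ r.+1 - (-1) ^+ r.+1) / 3 * S c + (-1) ^+ r.+1 * (P c c)%:R.
  move=> cD.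
  have -> : \sum_(h in D) ((h != c) && P c h)%:R =
      \sum_(h in D) (h != c)%:R * (P c h)%:R :> rat.
    by apply: eq_bigr => h _; rewrite -natrM mulnb.
  have -> : \sum_(h in D) \sum_(e in D) ((h != c) && P c e)%:R =
      \sum_(h in D) (h != c)%:R * S c.
    apply: eq_bigr => h _; rewrite mulr_sumr /=.
    by apply: eq_bigr => e _; rewrite -natrM mulnb.
  by rewrite !sub_c // -/(S c) sumr_const card_D !exprS; field.
rewrite [X in _ = X + _]mulr_sumr [X in _ = _ + X]mulr_sumr -big_split /= [RHS]big_mkcond.
apply: eq_bigr => c _; case: ifP => cD; last by rewrite mul0r.
by rewrite mul1r stepE.
Qed.

End Walks.

(** * Sums over residues grouped by gcd *)

(** The k < m with gcd(k, m) = d are the products d j with j < m/d coprime to m/d; k = 0 falls under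
    d = m. *)
Lemma sum_gcdn (W : nmodType) m (f : nat -> W) : (0 < m)%N ->
  \sum_(k < m) f (gcdn k m) = \sum_(d <- divisors m) f d *+ totient (m %/ d).
Proof.
move=> m0.
transitivity (\sum_(d <- divisors m) \sum_(k < m | gcdn k m == d) f d).
  rewrite (exchange_big_dep xpredT) //=; apply: eq_bigr => k _.
  rewrite -big_filter (_ : [seq d <- _ | _] = [:: gcdn k m]) ?big_seq1 //.
  rewrite (eq_filter (a2 := pred1 (gcdn k m))) => [|d]; last by rewrite /= eq_sym.
  by rewrite filter_pred1_uniq ?divisors_uniq // -dvdn_divisors // dvdn_gcdr.
rewrite big_seq [RHS]big_seq; apply: eq_bigr => d; rewrite -dvdn_divisors // => dm.
have d0 : (0 < d)%N by exact: dvdn_gt0 dm.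
rewrite sumr_const; congr (_ *+ _).
have q0 : (0 < m %/ d)%N by rewrite divn_gt0 // dvdn_leq.
have lt_mul (j : 'I_(m %/ d)) : (d * j < m)%N.
  by rewrite -[X in (_ < X)%N](divnK dm) mulnC ltn_pmul2r.
have gcd_mul j : (gcdn (d * j) m == d) = coprime (m %/ d) j.
  rewrite -[X in gcdn _ X](divnK dm) [(_ * d)%N]mulnC -muln_gcdr gcdnC.
  by rewrite -[X in _ == X]muln1 eqn_pmul2l.
rewrite totient_count_coprime big_mkord -big_mkcond sum1_card.
rewrite -(card_imset _ (f := fun j => Ordinal (lt_mul j))); last first.
  by move=> i j /(congr1 val) /eqP; rewrite /= eqn_pmul2l // => /eqP /val_inj.
apply: eq_card => k; apply/idP/imsetP => [kd|[j jc ->]]; last first.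
  by rewrite unfold_in /=; apply: etrans (gcd_mul j) jc.
have dk : (d %| k)%N by rewrite -(eqP kd) dvdn_gcdl.
have lt_div : (k %/ d < m %/ d)%N by rewrite ltn_divRL // divnK.
exists (Ordinal lt_div); last by apply: val_inj; rewrite /= mulnC divnK.
by apply: etrans (esym (gcd_mul _)) _; rewrite /= mulnC divnK.
Qed.

(** * Arcs as elements of Z/m *)

Section CyclicModel.
(** Writing [m] as [p.+2] gives ['I_m] the ring structure of Z/m, with 1 distinct from 0. *)
Variable p : nat.
Local Notation m := p.+2.
Local Notation Zm := 'I_m.
Local Notation GL2 := {'GL_2['F_2]}.
Local Notation V := 'cV['F_2]_2.
Local Notation map := {ffun Zm -> V}.
Local Notation "a *v x" := (GLval a *m x) (at level 40).
Local Notation D := [set v : V | v != 0].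
Local Notation walk := (walk (0 : V) D).

Lemma val_ordS (i : Zm) : val (i + 1) = (i.+1 %% p.+2)%N.
Proof. by rewrite /= modnDmr addn1. Qed.

Lemma adjacentP (R : realType) (i j : Zm) : adjacent R i j <-> j = i + 1 \/ i = j + 1.
Proof.
have vE (a k : Zm) : (arc p.+2 a : set R[i]) (vertex p.+2 k) <-> k = a \/ k = a + 1.
  rewrite vertex_arc // -val_ordS.
  by split=> -[] h; [left|right|left|right]; do ?[exact: val_inj|rewrite h].
have n1 (a : Zm) : a <> a + 1.
  by move/eqP; rewrite -subr_eq0 opprD addNKr oppr_eq0 oner_eq0.
split=> [[ij [k [/vE[] ki /vE[] kj]]]|[->|->]].
- by case: ij; rewrite -ki -kj.
- by right; rewrite -ki.
- by left; rewrite -kj.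
- by case: ij; apply: (addIr 1); rewrite -ki -kj.
- by split; [exact: n1|exists (i + 1); split; apply/vE; [right|left]].
- by split; [move/esym; exact: n1|exists (j + 1); split; apply/vE; [left|right]].
Qed.

Definition proper (l : {ffun Zm -> 'cV['F_2]_2}) :=
  [forall i, (l i != 0) && (l i != l (i + 1))].

Lemma coloringsE (R : realType) l : (l \in colorings R p.+2) = proper l.
Proof.
rewrite inE; apply/asboolP/forallP => [[l0 ll] i|h].
  by apply/andP; split; apply/eqP; [exact: l0|apply: ll; apply/adjacentP; left].
split=> [i|i j /adjacentP[->|->]]; have [] := andP (h i) => /eqP // _ /eqP //.
by have [_ /eqP nj _ /esym] := andP (h j).
Qed.

Definition dihedral_fun (k : Zm) (b : bool) (i : Zm) : Zm :=
  if b then k - i else k + i.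

Lemma dihedral_fun_inj k b : injective (dihedral_fun k b).
Proof. by case: b => i j /addrI // /oppr_inj. Qed.

Definition dihedral_perm k b : 'S_p.+2 := perm (@dihedral_fun_inj k b).

Lemma dihedral_permE k b i : dihedral_perm k b i = if b then k - i else k + i.
Proof. by rewrite permE. Qed.

Lemma arc_permsE (R : realType) s :
  reflect (exists k b, s = dihedral_perm k b) (s \in arc_perms R p.+2).
Proof.
have arcE (n : nat) (j : Zm) : (arc p.+2 n = arc p.+2 j :> set R[i]) <-> j = inZp n.
  rewrite -(arc_mod R (isT : 0 < p.+2)%N n); split=> [h|->] //.
  by apply/esym; exact: (arc_inj (isT : 0 < p.+2)%N (i := inZp n) h).
(* The reflection of parameter [k] reverses arcs and so induces i |-> k - 1 - i. Hence the shift by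
   one between geometric parameters and those of [dihedral_perm] below. *)
have reflE (k i : Zm) : inZp (k + (p.+1 - i)) = k - 1 - i.
  apply: (addIr (i + 1)); rewrite [in RHS]addrA !subrK.
  rewrite -[X in _ + (X + 1)]valZpK -[k in RHS]valZpK -!Zp_nat.
  rewrite -[1]/(1%:R) -!natrD /=.
  have -> : (k + (p.+1 - i) + (i + 1) = k + p.+2)%N by have := ltn_ord i; lia.
  rewrite natrD [p.+2%:R]Zp_nat (_ : inZp p.+2 = 0) ?addr0 //.
  by apply: val_inj; rewrite /= modnn.
apply: (iffP idP) => [|[k [b ->]]].
- rewrite inE => /asboolP [g [k [->|->]] h].
  + exists k, false; apply/permP => i; rewrite dihedral_permE.
    by have := h i; rewrite rotation_arc // => /arcE ->; apply: val_inj.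
  + exists (k - 1), true; apply/permP => i; rewrite dihedral_permE.
    by have := h i; rewrite reflection_arc // => /arcE ->.
- rewrite inE; apply/asboolP; case: b.
  + exists (reflection (pi * (k + 1 : Zm)%R%:R / p.+2%:R)); first by exists (k + 1); right.
    move=> i; rewrite reflection_arc //; apply/arcE.
    by rewrite dihedral_permE reflE addrK.
  + exists (rotation (2 * pi * k%:R / p.+2%:R)); first by exists k; left.
    move=> i; rewrite rotation_arc //; apply/arcE.
    by rewrite dihedral_permE; apply: val_inj.
Qed.

Definition fixed_colorings (a : GL2) (k : Zm) (b : bool) :=
  [set l : map | proper l && (act a (dihedral_perm k b) l == l)].

(** * Orbit counting for the product of the two groups *)

Section Burnside.
Variable R : realType.
Local Open Scope group_scope.

Lemma dihedral_permM k b k' b' : exists k'' b'',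
  dihedral_perm k b * dihedral_perm k' b' = dihedral_perm k'' b'' :> 'S_p.+2.
Proof.
exists (if b' then k' - k else k' + k)%R, (b (+) b'); apply/permP => i.
rewrite permM !dihedral_permE.
by case: b b' => [] []; rewrite /= ?opprD ?opprK ?addrA.
Qed.

Lemma arc_perms_group : group_set (arc_perms R p.+2).
Proof.
apply/group_setP; split=> [|s t /arc_permsE[k [b ->]] /arc_permsE[k' [b' ->]]].
  by apply/arc_permsE; exists 0%R, false; apply/permP => i; rewrite dihedral_permE perm1 add0r.
by apply/arc_permsE; exact: dihedral_permM.
Qed.
Canonical arc_perm_group := Group arc_perms_group.

(* [act] is a left action; MathComp's actions are right actions. *)
Definition dact (l : map) (a : GL2 * 'S_p.+2) : map := act a.1^-1 a.2^-1 l.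

Lemma act1 (l : map) : act 1 1 l = l.
Proof. by apply/ffunP=> i; rewrite ffunE perm1 GL_1E mul1mx. Qed.

Lemma actM (l : map) x y s t : act x s (act y t l) = act (x * y) (s * t) l.
Proof. by apply/ffunP=> i; rewrite !ffunE permM GL_MxE mulmxA. Qed.

Lemma dact1 : dact^~ 1 =1 id.
Proof. by move=> l; rewrite /dact /= !invg1 act1. Qed.

Lemma dactM l : act_morph dact l.
Proof. by move=> [a s] [b t]; rewrite /dact actM /= !invMg. Qed.

Canonical dact_action := TotalAction dact1 dactM.

Lemma proper_act a k b (l : map) : proper l -> proper (act a (dihedral_perm k b) l).
Proof.
move=> /forallP h; apply/forallP => i.
rewrite !ffunE !dihedral_permE GLv_eq0 (inj_eq (@GLv_inj a)).
case: b; last by rewrite addrA.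
have [-> _] := andP (h (k - i)%R).
have /andP[_] := h (k - (i + 1))%R.
by rewrite opprD addrA subrK eq_sym.
Qed.

(** The product of GL(2, Z_2) and [arc_perms] acts with the double orbits as its orbits. Passing
    from arc permutations to pairs [k], [b] multiplies the sum and the group order by the same
    factor. *)
Lemma burnside :
  (#|double_coset R p.+2| * (6 * (2 * p.+2)) =
  \sum_(a : GL2) \sum_(k : Zm) \sum_(b : bool)
     #|fixed_colorings a k b|)%N.
Proof.
pose G : {group GL2 * 'S_p.+2} := [group of setX [set: GL2] (arc_perms R p.+2)].
pose F a s := #|[set l : map | proper l && (act a s l == l)]|.
have arcV s : (s^-1 \in arc_perms R p.+2) = (s \in arc_perms R p.+2).
  exact: (groupV (arc_perm_group)).
have Sacts : [acts G, on colorings R p.+2 | dact_action].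
  have -> : colorings R p.+2 = [set l | proper l] by apply/setP=> l; rewrite coloringsE inE.
  apply/subsetP => -[a s] /setXP[_ sG]; rewrite !inE /=; apply/subsetP => l.
  rewrite !inE /= /dact /=.
  have /arc_permsE [k [b ->]] : s^-1 \in arc_perms R p.+2 by rewrite arcV.
  exact: proper_act.
have orbE l : orbit dact_action G l = double_orbit R l.
  apply/setP => y; apply/orbitP/imset2P => [[[a s] /setXP[_ sG] <-]|[a s _ sG ->]].
    by rewrite -arcV in sG; exists a^-1 s^-1.
  exists (a^-1, s^-1); first by apply/setXP; split; rewrite ?arcV ?in_setT.
  by rewrite /= /dact /= !invgK.
have cardGL : #|{: GL2}| = 6%N.
  by rewrite -cardsT -/'GL_2['F_2] card_GL_2 card_Fp.
have := Frobenius_Cauchy Sacts.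
rewrite (eq_imset _ orbE) -/(double_coset R p.+2) cardsX cardsT cardGL.
have -> : (\sum_(x in G) #|'Fix_(colorings R p.+2 | dact_action)[x]| =
   \sum_(a : GL2) \sum_(s in arc_perms R p.+2) F a s)%N.
  (* Reindexing by inversion cancels the inverses in [dact]. *)
  rewrite pair_big_dep /= (reindex_inj invg_inj) /=.
  apply: eq_big => [[a s]|[a s] _]; first by rewrite in_setX in_setT; exact: (arcV s).
  apply: eq_card => l; rewrite [RHS]inE in_setI coloringsE; congr (_ && _).
  apply/afix1P/eqP; rewrite /= /dact /= !invgK //.
(* Each arc permutation is induced by c elements of the dihedral group:
   c = 2 if m = 2, and c = 1 otherwise. *)
pose c := (1 + (dihedral_perm (0 : Zm)%R true == dihedral_perm (0 : Zm)%R false))%N.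
have fibre s : s \in arc_perms R p.+2 ->
   (\sum_(k : Zm) \sum_(b : bool) (dihedral_perm k b == s) = c)%N.
  move=> /arc_permsE [k [b ->]].
  (* The image of 0 is [k], so only [b] can be ambiguous. *)
  have k0 k' b' b'' : (dihedral_perm k' b' == dihedral_perm k b'') ->
     k' = k.
    move=> /eqP/permP/(_ 0%R); rewrite !dihedral_permE subr0 addr0.
    by case: b' b'' => [] []; rewrite ?addr0 ?subr0.
  rewrite (bigD1 k) //= [X in (_ + X)%N]big1 ?addn0; last first.
    move=> k' nk; rewrite big1 // => b' _.
    by case: eqP => // /eqP /k0 e; rewrite e eqxx in nk.
  have tf : (dihedral_perm k true == dihedral_perm k false) =
     (dihedral_perm (0 : Zm)%R true == dihedral_perm (0 : Zm)%R false).
    by apply/eqP/eqP => /permP h; apply/permP => i; have := h i;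
      rewrite !dihedral_permE => /addrI; rewrite ?add0r // => ->.
  rewrite big_bool /c -tf; case: b; rewrite eqxx; first by rewrite eq_sym.
  by rewrite addnC.
have sumE (f : 'S_p.+2 -> nat) :
   (\sum_(k : Zm) \sum_(b : bool) f (dihedral_perm k b) =
    c * \sum_(s in arc_perms R p.+2) f s)%N.
  rewrite big_distrr /=.
  under [RHS]eq_bigr => s sG do
    rewrite -(fibre s sG) big_distrl /=.
  rewrite [RHS]exchange_big; apply: eq_bigr => k _ /=.
  under [RHS]eq_bigr => s sG do rewrite big_distrl /=.
  rewrite [RHS]exchange_big; apply: eq_bigr => b _ /=.
  rewrite (bigD1 (dihedral_perm k b)) /=; last by apply/arc_permsE; exists k, b.
  rewrite eqxx mul1n big1 ?addn0 // => s /andP[_ /negPf].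
  by rewrite eq_sym => ->.
have cardG : (2 * p.+2 = c * #|arc_perms R p.+2|)%N.
  rewrite -sum1_card -sumE.
  by under eq_bigr do rewrite big_const card_bool; rewrite sum_nat_const card_ord mulnC.
move=> h; under eq_bigr do rewrite (sumE (F _)).
by rewrite -big_distrr /= h cardG (mulnCA 6) mulnCA.
Qed.

End Burnside.

(** * Fixed colorings *)

Lemma natZm0 : m%:R = 0 :> Zm.
Proof. by rewrite Zp_nat; apply: val_inj; rewrite /= modnn. Qed.

Lemma natZmK (i : Zm) : (i : nat)%:R = i.
Proof. by rewrite Zp_nat valZpK. Qed.

Lemma val_natZm j : (j%:R : Zm) = (j %% m)%N :> nat.
Proof. by rewrite Zp_nat. Qed.

Lemma properP (l : map) :
  reflect (forall j, l j%:R != 0 /\ l j%:R != l j.+1%:R) (proper l).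
Proof.
apply: (iffP forallP) => h i.
  by have /andP := h i%:R; rewrite -natr1.
by have [h1 h2] := h i; rewrite -natr1 natZmK in h2; rewrite natZmK in h1; rewrite h1 h2.
Qed.

Definition unroll (L : nat -> V) : map := [ffun i : Zm => L i].

Lemma proper_unroll (L : nat -> V) :
  (forall j, (j < m)%N -> L j != 0) -> (forall j, (j.+1 < m)%N -> L j != L j.+1) ->
  L m.-1 != L 0%N -> proper (unroll L).
Proof.
move=> L0 LS Lm; apply/forallP => i; rewrite !ffunE L0 // andTb.
rewrite -[nat_of_ord (i + 1)]/(val (i + 1)) val_ordS.
have := ltn_ord i; rewrite leq_eqVlt => /orP[/eqP e|h]; last by rewrite modn_small // LS.
by rewrite e modnn; have -> : i = m.-1 :> nat by case: e.
Qed.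

(* The colorings in Q are determined by the colors of their first n arcs, which
   L extends to the whole circle. *)
Lemma card_fold n (Q : pred map) (Q' : pred (n.-tuple V)) (L : n.-tuple V -> nat -> V) :
  (n <= m)%N ->
  (forall (l : map) (t : n.-tuple V), Q l -> (forall j, (j < n)%N -> nth 0 t j = l j%:R) ->
     Q' t /\ forall j, (j < m)%N -> L t j = l j%:R) ->
  (forall t : n.-tuple V, Q' t ->
     Q (unroll (L t)) /\ forall j, (j < n)%N -> L t j = nth 0 t j) ->
  #|[set l | Q l]| = #|[set t | Q' t]|.
Proof.
move=> nm h1 h2.
pose res (l : map) := [tuple l (i : nat)%:R | i < n].
have resE l j : (j < n)%N -> nth 0 (res l) j = l j%:R.
  by move=> jn; rewrite -(tnth_nth 0 (res l) (Ordinal jn)) tnth_mktuple.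
have cancel_res l : Q l -> unroll (L (res l)) = l.
  move=> Ql; have [_ h] := h1 l (res l) Ql (resE l).
  by apply/ffunP => i; rewrite ffunE h // natZmK.
rewrite -(card_in_imset (f := res) (D := [set l | Q l])); last first.
  by move=> l l'; rewrite !inE => /cancel_res {2}<- /cancel_res {2}<- ->.
apply: eq_card => t; apply/imsetP/idP => [[l]|].
  by rewrite !inE => Ql ->; have [] := h1 l (res l) Ql (resE l).
rewrite inE => Q't; have [QL Lt] := h2 t Q't; exists (unroll (L t)); first by rewrite inE.
apply/val_inj/(@eq_from_nth _ 0); first by rewrite !size_tuple.
move=> j; rewrite size_tuple => jn; rewrite resE // ffunE val_natZm modn_small ?Lt //.
exact: leq_trans jn nm.
Qed.

Lemma walkP r (P : rel V) (t : r.+1.-tuple V) :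
  reflect [/\ forall j, (j <= r)%N -> nth 0 t j != 0,
              forall j, (j < r)%N -> nth 0 t j != nth 0 t j.+1 &
              P (nth 0 t 0%N) (nth 0 t r)]
          (walk P t).
Proof.
apply: (iffP and3P) => -[h1 h2 h3]; split=> //.
- move=> j jr; have := all_nthP 0 h1 j; rewrite size_tuple ltnS => /(_ jr).
  by rewrite /= inE.
- move=> j jr; have /(sortedP 0) := h2; apply.
  by rewrite size_tuple.
- apply/(all_nthP 0) => j; rewrite size_tuple ltnS => /h1.
  by rewrite /= inE.
- by apply/(sortedP 0) => j; rewrite size_tuple ltnS => /h2.
Qed.

(** Such a coloring satisfies l (q d + s) = a^q l (s), so its first [d] colors determine it, and the
    next color, [a] applied to the first one, must differ from the last of them. Conversely a^(m/d)
    = 1 makes the extension periodic modulo [m]. The length is written [d.-1.+1] to fit the nonempty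
    tuples of [walk]. *)
Lemma card_rotation d (a : GL2) : (0 < d)%N -> (d %| m)%N -> (a ^+ (m %/ d) = 1)%g ->
  #|[set l : map | proper l && [forall i, l (i + d%:R) == a *v l i]]| =
  #|[set t : d.-1.+1.-tuple V | walk (fun h e => e != a *v h) t]|.
Proof.
case: d => // r _ dm am; rewrite [r.+1.-1]/=; set d := r.+1 in dm am *.
pose L (t : d.-tuple V) j := (a ^+ (j %/ d))%g *v nth 0 t (j %% d).
apply: (@card_fold _ _ _ L) => [|l t /andP[/properP pl /forallP dl] tl|t /walkP[t0 tS tP]].
- exact: dvdn_leq.
- split.
    apply/walkP; split=> [j jr|j jr|].
    + by rewrite tl //; have [] := pl j.
    + by rewrite (tl j (ltnW jr)) tl //; have [] := pl j.
    + rewrite !tl //; have /eqP <- := dl 0%:R; rewrite -natrD add0n.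
      by have [] := pl r.
  move=> j _; rewrite /L tl ?ltn_mod // [in RHS](divn_eq j d).
  elim: (j %/ d)%N => [|q IH]; first by rewrite expg0 GLv1 mul0n.
  rewrite expgS GLvM IH mulSn -addnA [in RHS]addnC.
  by have /eqP := dl (q * d + j %% d)%:R; rewrite -natrD => <-.
- have LD j : L t (j + d)%N = a *v L t j.
    by rewrite /L modnDr divnDr // divnn /= addn1 expgS GLvM.
  have Lm j : L t (j %% m)%N = L t j.
    rewrite [in RHS](divn_eq j m); elim: (j %/ m)%N => [|q ->]; first by rewrite mul0n.
    rewrite mulSn -addnA [in RHS]addnC -[X in _ = L t (_ + X)%N](divnK dm).
    suff LDq n k : L t (k + n * d)%N = (a ^+ n)%g *v L t k by rewrite LDq am GLv1.
    elim: n => [|n IHn]; first by rewrite expg0 GLv1 addn0.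
    by rewrite mulSn addnCA addnC LD IHn expgS GLvM.
  have L0 j : L t j != 0 by rewrite GLv_eq0 t0 // -ltnS ltn_mod.
  have LS j : L t j != L t j.+1.
    rewrite (divn_eq j d) -addnS; elim: (j %/ d)%N => [|q IH]; last first.
      rewrite mulSn -!addnA ![(d + _)%N]addnC !LD.
      by rewrite (inj_eq (@GLv_inj _)).
    rewrite !mul0n !add0n; have := ltn_mod j d; rewrite ltnS leq_eqVlt.
    have Ls k : (k < d)%N -> L t k = nth 0 t k.
      by move=> kd; rewrite /L divn_small // modn_small // expg0 GLv1.
    move=> /orP[/eqP -> |jr]; last by rewrite !Ls ?tS // ltnW.
    by rewrite -[r.+1]/(0 + d)%N LD !Ls // eq_sym.
  split; last by move=> j jd; rewrite /L divn_small // modn_small // expg0 GLv1.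
  apply/andP; split.
    apply: proper_unroll => //; have <- : L t m = L t 0%N by rewrite -(Lm m) modnn.
    exact: LS.
  apply/forallP => i; rewrite !ffunE -LD -[X in _ == X]Lm Zp_nat; apply/eqP; congr (L t _).
  by rewrite /= modnDmr.
Qed.

(* The reflection i |-> M - i is i |-> -1 - i if e = false, with axis through
   the vertex 0, and i |-> -i if e = true, with axis through the arc 0; the
   other end of the axis meets an arc iff M is even.  An arc met by the axis
   has a color fixed by a, an arc next to a vertex on the axis does not. *)
Lemma card_reflection (e : bool) (a : GL2) : (a ^+ 2 = 1)%g ->
  let M := (m.-1 + e)%N in
  #|[set l : map | proper l && [forall i, a *v l (M%:R - i) == l i]]| =
  #|[set t : (M./2).+1.-tuple V |
      walk (fun h f => ((a *v h == h) == e) && ((a *v f == f) == ~~ odd M)) t]|.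
Proof.
move=> a2 M; have Me : M = (m.-1 + e)%N by []; clearbody M; set r := M./2.
have aK (v : V) : a *v (a *v v) = v by rewrite -GLvM -[X in GLval X]/(a ^+ 2)%g a2 GLv1.
have Mr : M = (odd M + r.*2)%N by rewrite odd_double_half.
clearbody r; have eM : (M = m \/ M = m.-1)%N by rewrite Me; case: (e); [left|right]; rewrite ?addn0 ?addn1.
(* Arcs 0 to [r] carry the walk; a later arc [j] is the mirror image of M - j. *)
pose L (t : r.+1.-tuple V) j := if (j <= r)%N then nth 0 t j else a *v nth 0 t (M - j).
apply: (@card_fold _ _ _ L) => [|l t /andP[/properP pl /forallP dl] tl|t /walkP[t0 tS /andP[/eqP P0 /eqP Pr]]].
- by move: eM Mr; case: (odd M) => /=; lia.
- have dlN j : (j <= M)%N -> a *v l (M - j)%:R = l j%:R.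
    by move=> jM; rewrite natrB //; exact/eqP.
  split; last first.
    move=> j jm; rewrite /L; case: leqP => jr; first by rewrite tl.
    rewrite tl; last by move: eM Mr; case: (odd M) => /=; lia.
    by rewrite dlN //; move: eM; lia.
  apply/walkP; split=> [j jr|j jr|].
  + by rewrite tl //; have [] := pl j.
  + by rewrite (tl j (ltnW jr)) tl //; have [] := pl j.
  + rewrite !tl //; apply/andP; split.
      have := dlN 0%N (leq0n _); rewrite subn0 Me; case: (e) => h.
        by rewrite eqb_id -{2}h addn1 natZm0.
      rewrite addn0 in h; rewrite eqbF_neg.
      rewrite -{1}h aK; have [_] := pl m.-1.
      by rewrite -[m.-1.+1]/m natZm0.
    have := dlN r; case: (odd M) Mr => /= Mr.
      have -> : (M - r = r.+1)%N by lia.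
      move=> h; rewrite eqbF_neg -{2}h; last by lia.
      rewrite (inj_eq (@GLv_inj _)).
      by have [] := pl r.
    have -> : (M - r = r)%N by lia.
    by move=> ->; [rewrite eqxx|lia].
- have Lt j : (j <= r)%N -> L t j = nth 0 t j by rewrite /L => ->.
  have Lgt j : (r < j)%N -> L t j = a *v nth 0 t (M - j) by rewrite /L ltnNge => /negPf ->.
  split=> //; apply/andP; split.
    apply: proper_unroll => [j jm|j jm|].
    + case: (leqP j r) => jr; first by rewrite Lt ?t0.
      by rewrite Lgt // GLv_eq0 t0 //; move: eM Mr; case: (odd M) => /=; lia.
    + have [jr|jr|->] := ltngtP j r.
      * by rewrite !Lt ?tS // ltnW.
      * rewrite !Lgt //; last exact: ltnW.
        rewrite (inj_eq (@GLv_inj _)) eq_sym (_ : M - j = (M - j.+1).+1)%N; last by lia.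
        by apply: tS; move: eM Mr; case: (odd M) => /=; lia.
      (* The far end of the axis. For odd [M], arcs [r] and r + 1 are mirror images; for even [M],
         arc [r] is its own mirror image and r + 1 mirrors r - 1. *)
      * rewrite Lt // Lgt //; case: (odd M) Mr Pr => /= Mr Pr.
          rewrite (_ : M - r.+1 = r)%N; last by lia.
          by rewrite eq_sym; apply/eqP/eqP; rewrite Pr.
        have /eqP Pr' : a *v nth 0 t r == nth 0 t r by rewrite Pr.
        rewrite -{1}Pr' (inj_eq (@GLv_inj _)) (_ : M - r.+1 = r.-1)%N; last by lia.
        have r0 : (0 < r)%N by move: eM; lia.
        by have := tS r.-1; rewrite (prednK r0) eq_sym; apply.
    (* The near end. Arc m - 1 mirrors arc 0 if [e] is false and arc 1 if [e] is true; in the latter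
       case with m = 2 it already belongs to the walk. *)
    + rewrite [L t 0%N]Lt //; case: (e) P0 Me => P0 Me; last first.
        rewrite Lgt; last by move: Me Mr; case: (odd M) => /=; lia.
        rewrite (_ : M - m.-1 = 0)%N; last by lia.
        by rewrite P0.
      have /eqP P0' : a *v nth 0 t 0%N == nth 0 t 0%N by rewrite P0.
      have t01 : nth 0 t 1 != nth 0 t 0%N.
        by rewrite eq_sym tS //; move: Me Mr; case: (odd M) => /=; lia.
      case: (leqP m.-1 r) => mr.
        have -> : m.-1 = 1%N by move: Me Mr; case: (odd M) => /=; lia.
        by rewrite Lt //; move: Me Mr; case: (odd M) => /=; lia.
      rewrite Lgt // (_ : M - m.-1 = 1)%N; last by lia.
      by rewrite -P0' (inj_eq (@GLv_inj _)).
  apply/forallP => i; rewrite !ffunE; apply/eqP.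
  (* M - i leaves the range of indices only for M = m and i = 0, where arc 0 is its own mirror
     image. *)
  have [im|im] := ltnP (M - i) m; last first.
    have Mm : M = m by move: eM; lia.
    have i0 : i = 0%N :> nat by lia.
    have e1 : e by case: (e) Me; lia.
    have /eqP P0' : a *v nth 0 t 0%N == nth 0 t 0%N by rewrite P0.
    have -> : i = 0 by apply: val_inj.
    by rewrite Mm natZm0 subr0 Lt.
  have iM : (i <= M)%N by have := ltn_ord i; move: eM; lia.
  have -> : M%:R - i = (M - i)%:R :> Zm by rewrite natrB // natZmK.
  rewrite val_natZm modn_small //.
  case: (leqP i r) => ir; last first.
    rewrite Lt; last by move: Mr; case: (odd M) => /=; lia.
    by rewrite Lgt.
  case: (leqP (M - i) r) => Mir; last by rewrite Lgt // Lt // subKn.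
  rewrite !Lt //; case: (odd M) Mr Pr => /= Mr Pr; first by lia.
  have /eqP Pr' : a *v nth 0 t r == nth 0 t r by rewrite Pr.
  have -> : i = r :> nat by lia.
  by rewrite (_ : M - r = r)%N //; lia.
Qed.

(** * Fixed colorings summed over GL(2, Z_2) *)

Lemma act_fixedP a k b (l : map) :
  (act a (dihedral_perm k b) l == l) =
  [forall i, a *v l (if b then k - i else k + i) == l i].
Proof.
apply/eqP/forallP => [h i|h]; last by apply/ffunP=> i; rewrite ffunE dihedral_permE; apply/eqP.
by rewrite -{2}h ffunE dihedral_permE.
Qed.

Lemma GLvX_fix (a : GL2) j (v : V) : a *v v = v -> (a ^+ j)%g *v v = v.
Proof. by move=> av; elim: j => [|j IH]; rewrite ?expg0 ?GLv1 // expgS GLvM IH. Qed.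

Lemma sum_colors_neq (W : zmodType) (f : V -> W) (u : V) : u != 0 ->
  \sum_(v in D | v != u) f v = \sum_(v in D) f v - f u.
Proof. by move=> u0; rewrite [in RHS](bigD1 u) ?inE //= addrAC subrr add0r. Qed.

Lemma sum_fixed (a : GL2) : \sum_(v in D) (a *v v == v)%:R = #|fixed_colors a|%:R :> rat.
Proof.
rewrite -sum1_card natr_sum big_mkcond [RHS]big_mkcond /=; apply: eq_bigr => v _.
by rewrite !inE; case: (v == 0); case: (_ == _).
Qed.

Lemma sum_nonfixed (a : GL2) :
  \sum_(v in D) (a *v v != v)%:R = 3 - #|fixed_colors a|%:R :> rat.
Proof.
rewrite -sum_fixed; apply/eqP; rewrite eq_sym subr_eq -big_split /=.
rewrite (eq_bigr (fun=> 1)) ?sumr_const ?card_colors // => v _.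
by case: (_ == _).
Qed.

(** With n = m/d, n rotations by [k] are the identity, so a^n fixes two adjacent colors of any fixed
    coloring and is therefore 1. If a^n = 1, the rotation by [k] is traded for the rotation by its
    gcd [d] with [m], and the fixed colorings become walks. *)
Lemma card_fixed_rotation (a : GL2) (k : Zm) :
  #|fixed_colorings a k false|%:R =
    if (a ^+ (m %/ gcdn k m) == 1)%g then
      2 ^+ gcdn k m - (-1) ^+ gcdn k m + (-1) ^+ gcdn k m * #|fixed_colors a|%:R
    else 0 :> rat.
Proof.
set d := gcdn k m; set n := (m %/ d)%N.
have d0 : (0 < d)%N by rewrite gcdn_gt0 orbT.
have dm : (d %| m)%N by rewrite dvdn_gcdr.
have dk : (d %| k)%N by rewrite dvdn_gcdl.
have fixX (l : map) : (forall i, a *v l (k + i) = l i) ->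
    forall j i, (a ^+ j)%g *v l ((j * k)%:R + i) = l i.
  move=> h; elim=> [|j IH] i; first by rewrite expg0 GLv1 mul0n add0r.
  by rewrite expgSr GLvM mulSn natrD -addrA natZmK h IH.
have [an|an] := eqVneq; last first.
  apply/eqP; rewrite pnatr_eq0 cards_eq0; apply/eqP/setP => l; rewrite !inE.
  apply/negP => /andP[/properP pl]; rewrite act_fixedP => /forallP h.
  have fl i : (a ^+ n)%g *v l i = l i.
    have := fixX l (fun i => eqP (h i)) n i.
    have /dvdnP[q ->] : (m %| n * k)%N by rewrite -[X in (X %| _)%N](divnK dm) dvdn_pmul2l // divn_gt0 // dvdn_leq.
    by rewrite natrM natZm0 mulr0 add0r.
  have [[l0 l01] [l1 _]] := (pl 0%N, pl 1%N).
  by move/eqP: an; apply; exact: GL2_fix2 l0 l1 l01 (fl _) (fl _).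
(* Here x k = -d modulo [m], so being fixed by [a] and [k] amounts to l (i + d) = t l (i) with t =
   a^x. Since a t^q = 1, [t] and [a] are powers of each other up to inversion and fix the same
   colors. *)
have [x _ mx] := Bezoutl k (isT : 0 < m)%N; rewrite gcdnC -/d in mx.
pose t := (a ^+ x)%g; pose q := (k %/ d)%N.
have tq : (a * t ^+ q = 1)%g.
  have /dvdnP[y xy] : (n %| 1 + x * q)%N.
    by rewrite -(dvdn_pmul2r d0) divnK // mulnDl mul1n -mulnA divnK.
  by rewrite -expgM -expgS -[(x * q).+1]add1n xy mulnC expgM an expg1n.
have tn : (t ^+ n = 1)%g by rewrite -expgM mulnC expgM an expg1n.
have fixt : fixed_colors t = fixed_colors a.
  apply/setP => v; rewrite !inE; congr (_ && _); apply/eqP/eqP => [tv|]; last exact: GLvX_fix.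
  by rewrite -{1}(GLvX_fix q tv) -GLvM tq GLv1.
have -> : fixed_colorings a k false =
    [set l : map | proper l && [forall i, l (i + d%:R) == t *v l i]].
  apply/setP => l; rewrite !inE act_fixedP; congr (_ && _).
  apply/forallP/forallP => h i; apply/eqP.
    rewrite -(fixX l (fun i => eqP (h i)) x (i + d%:R)) addrCA -natrD addnC.
    by case/dvdnP: mx => y ->; rewrite natrM natZm0 mulr0 addr0.
  have lq j : l (i + (j * d)%:R) = (t ^+ j)%g *v l i.
    elim: j => [|j IH]; first by rewrite mul0n addr0 expg0 GLv1.
    by rewrite mulSn addnC natrD addrA (eqP (h _)) IH expgS GLvM.
  by rewrite addrC -{1}(natZmK k) -(divnK dk) lq -GLvM tq GLv1.
rewrite card_rotation // (card_walks _ card_colors).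
have -> : \sum_(c in D) \sum_(e in D) (e != t *v c)%:R = 6 :> rat.
  rewrite (eq_bigr (fun=> 2)) ?sumr_const ?card_colors // => c; rewrite inE => c0.
  rewrite (eq_bigr (fun e => if e != t *v c then 1 else 0)) => [|e _]; last by case: ifP.
  by rewrite -big_mkcondr sum_colors_neq ?GLv_eq0 // sumr_const card_colors.
have -> : \sum_(c in D) (c != t *v c)%:R = 3 - #|fixed_colors a|%:R :> rat.
  by rewrite -fixt -sum_nonfixed; apply: eq_bigr => v _; rewrite eq_sym.
by move: d0; case: (d) => // r _; rewrite [r.+1.-1]/= !exprS; field.
Qed.

(** This is where [alpha] and [beta] come from: the identity contributes A(d), the transpositions 3
    2^d = 2 A(d) + 2 A(d-1), and the 3-cycles 2 (2^d - (-1)^d) = A(d) + 2 A(d-1), each when its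
    order divides m/d. *)
Lemma sum_rotation (k : Zm) : let d := gcdn k m in
  \sum_(a : GL2) #|fixed_colorings a k false|%:R =
    alpha (gcdn (m %/ d) 6) * A d + beta (gcdn (m %/ d) 6) * A (d - 1) :> rat.
Proof.
move=> d; have d0 : (0 < d)%N by rewrite gcdn_gt0 orbT.
under eq_bigr do rewrite card_fixed_rotation.
rewrite -big_mkcond /= -/d.
rewrite (sum_fixed_colors (fun x => 2 ^+ d - (-1) ^+ d + (-1) ^+ d * x%:R)).
set n := (m %/ d)%N.
have -> : (2 %| n)%N = (2 %| gcdn n 6)%N by rewrite dvdn_gcd andbT.
have -> : (3 %| n)%N = (3 %| gcdn n 6)%N by rewrite dvdn_gcd andbT.
have : (gcdn n 6 \in [:: 1; 2; 3; 6])%N.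
  by have := dvdn_gcdr n 6; rewrite dvdn_divisors.
rewrite !inE => /or4P[] /eqP ->; rewrite /alpha /beta /A /=;
  by case: (d) d0 => // r _; rewrite subn1 [r.+1.-1]/= !exprS; field.
Qed.

(* Conjugation by the rotation by j. *)
Lemma card_fixed_reflection_conj (a : GL2) (k j : Zm) :
  #|fixed_colorings a (k + j *+ 2) true| = #|fixed_colorings a k true|.
Proof.
pose shift (l : map) : map := [ffun i => l (i + j)].
have shift_inj : injective shift.
  by move=> l l' e; apply/ffunP => i; have := congr1 (fun h : map => h (i - j)) e;
    rewrite !ffunE subrK.
have shift_bij : bijective shift by exact: injF_bij.
rewrite -(card_imset _ shift_inj); apply: eq_card => l.
have [shift' shiftK' shiftK] := shift_bij.
rewrite -(shiftK l); move: (shift' l) => {}l.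
rewrite (mem_imset _ _ shift_inj) [LHS]inE [RHS]inE !act_fixedP.
congr (_ && _).
  apply/forallP/forallP => h i.
    by have := h (i + j); rewrite !ffunE [i + 1 + j]addrAC.
  by have := h (i - j); rewrite !ffunE [i - j + 1 + j]addrAC !subrK.
apply/forallP/forallP => h i.
  have := h (i + j); rewrite !ffunE (_ : k + j *+ 2 - (i + j) = k - i + j) //.
  by rewrite mulr2n; ring.
have := h (i - j); rewrite !ffunE subrK (_ : k - (i - j) + j = k + j *+ 2 - i) //.
by rewrite mulr2n; ring.
Qed.

(** The number of colors fixed ([b] true) or moved ([b] false) by an element that fixes [x] of the
    three colors. *)
Definition count_of_kind (b : bool) (x : nat) : rat := if b then x%:R else 3 - x%:R.

Lemma sum_count_of_kind (a : GL2) b : \sum_(v in D) ((a *v v == v) == b)%:R =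
  count_of_kind b #|fixed_colors a|.
Proof.
rewrite /count_of_kind; case: b; last first.
  by rewrite -sum_nonfixed; under eq_bigr do rewrite eqbF_neg.
by rewrite -sum_fixed; under eq_bigr do rewrite eqb_id.
Qed.

(** A reflection is an involution, so a^2 fixes every color of a fixed coloring and must be 1. The
    closing condition is a product of one condition per end, so the double sum over ends factors,
    and the diagonal survives only if both ends are of the same kind. *)
Lemma card_fixed_reflection (e : bool) (a : GL2) :
  let M := (m.-1 + e)%N in let r := M./2 in
  #|fixed_colorings a (M%:R : Zm) true|%:R =
    if (a ^+ 2 == 1)%g then
      (2 ^+ r - (-1) ^+ r) / 3 *
        (count_of_kind e #|fixed_colors a| * count_of_kind (~~ odd M) #|fixed_colors a|)
      + (-1) ^+ r * (if e == ~~ odd M then count_of_kind e #|fixed_colors a| else 0)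
    else 0 :> rat.
Proof.
move=> M r; have [a2|a2] := eqVneq; last first.
  apply/eqP; rewrite pnatr_eq0 cards_eq0; apply/eqP/setP => l; rewrite !inE.
  apply/negP => /andP[/properP pl]; rewrite act_fixedP => /forallP h.
  have fl i : (a ^+ 2)%g *v l i = l i.
    have := eqP (h (M%:R - i)); rewrite subKr => e1.
    by rewrite expgS expg1 GLvM e1 (eqP (h i)).
  have [[l0 l01] [l1 _]] := (pl 0%N, pl 1%N).
  by move/eqP: a2; apply; exact: GL2_fix2 l0 l1 l01 (fl _) (fl _).
have -> : fixed_colorings a (M%:R : Zm) true =
    [set l : map | proper l && [forall i, a *v l (M%:R - i) == l i]].
  by apply/setP => l; rewrite !inE act_fixedP.
rewrite card_reflection // (card_walks _ card_colors) -/M -/r.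
congr (_ * _ + _ * _).
  rewrite -!sum_count_of_kind mulr_suml; apply: eq_bigr => h _.
  by rewrite mulr_sumr; apply: eq_bigr => f _; rewrite -natrM mulnb.
case: eqP => [<-|/eqP ne]; last first.
  by rewrite big1 // => v _; case: eqP => // ->; rewrite (negPf ne).
by rewrite -sum_count_of_kind; under eq_bigr do rewrite andbb.
Qed.

(** Only the identity and the three transpositions satisfy a^2 = 1. For odd [m] the axis meets one
    arc and one vertex: the identity contributes 0 and the transpositions 2 (2^r - (-1)^r) = A(r+1).
    For even [m] it meets two arcs or two vertices, according to [e]. *)
Lemma sum_reflection (e : bool) :
  let M := (m.-1 + e)%N in
  \sum_(a : GL2) #|fixed_colorings a (M%:R : Zm) true|%:R =
    if odd m then A (m.+1 %/ 2)
    else (if e then 4 else 2) * 2 ^+ (m %/ 2)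
         + (if e then 2 else - 2) * (-1) ^+ (m %/ 2) :> rat.
Proof.
move=> M; have Me : M = (m.-1 + e)%N by []; clearbody M.
under eq_bigr do rewrite Me card_fixed_reflection -Me.
rewrite -big_mkcond /=.
rewrite (sum_fixed_colors (fun x =>
  (2 ^+ M./2 - (-1) ^+ M./2) / 3 * (count_of_kind e x * count_of_kind (~~ odd M) x)
  + (-1) ^+ M./2 * (if e == ~~ odd M then count_of_kind e x else 0)) 2) /=.
rewrite addr0 /count_of_kind !divn2.
have Mr := odd_double_half M; have mh := odd_double_half m.
have oM : odd M = ~~ odd m (+) e by rewrite Me oddD oddb /= negbK.
rewrite {}oM in Mr *.
have mS : (0 < m)%N by [].
have uE : m.+1./2 = (odd m + m./2)%N by rewrite -uphalf_half.
have m1 : m.-1 = (m - 1)%N by rewrite subn1.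
rewrite -[~~ ~~ odd p]/(odd m) uE; move: mh Mr Me; rewrite m1.
move: (m) (m./2) (M./2) mS => n h r n0.
case: (odd n) (e) => [] [] /= nh Mr Me.
- have -> : r = h by lia.
  by rewrite /A !exprS; field.
- have -> : r = h by lia.
  by rewrite /A !exprS; field.
- have -> : r = h by lia.
  by rewrite ?exprS; field.
- have -> : h = r.+1 by lia.
  by rewrite ?exprS; field.
Qed.

Lemma sum_parity (W : nmodType) n (x y : W) : ~~ odd n ->
  \sum_(k < n) (if odd k then x else y) = (x + y) *+ n./2.
Proof.
move=> /even_halfK <-; rewrite doubleK; elim: n./2 => [|h IH]; first by rewrite big_ord0.
by rewrite doubleS !big_ord_recr /= IH odd_double /= mulrSr -addrA [y + x]addrC.
Qed.

(** Up to conjugation by rotations, odd [k] reduces to m - 1 and even [k] to [m]. For odd [m] both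
    give the same sum; for even [m] each occurs m/2 times and the terms in (-1)^(m/2) cancel. *)
Lemma sum_reflections :
  \sum_(k : Zm) \sum_(a : GL2) #|fixed_colorings a k true|%:R = 6 * E m :> rat.
Proof.
pose T (k : Zm) : rat := \sum_(a : GL2) #|fixed_colorings a k true|%:R.
have TD k j : T (k + j *+ 2) = T k.
  by apply: eq_bigr => a _; rewrite card_fixed_reflection_conj.
have Todd (k : nat) : odd k -> T k%:R = T (m.-1 + false)%:R.
  move=> ok; rewrite -(TD (m.-1 + false)%:R (k.+1./2)%:R); congr T.
  rewrite -mulrnA -natrD.
  have -> : (m.-1 + false + k.+1./2 * 2 = k + m)%N by have := odd_double_half k.+1; lia.
  by rewrite natrD natZm0 addr0.
have Teven (k : nat) : ~~ odd k -> T k%:R = T (m.-1 + true)%:R.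
  move=> ok; rewrite -(TD (m.-1 + true)%:R (k./2)%:R); congr T.
  rewrite -mulrnA -natrD.
  have -> : (m.-1 + true + k./2 * 2 = k + m)%N by have := odd_double_half k; lia.
  by rewrite natrD natZm0 addr0.
have TE (k : Zm) : T k = if odd k then T (m.-1 + false)%:R else T (m.-1 + true)%:R.
  by rewrite -{1}(natZmK k); case: ifPn; [exact: Todd|exact: Teven].
rewrite (eq_bigr _ (fun k _ => TE k)) /T !sum_reflection /E.
case: ifPn => om.
  rewrite (eq_bigr (fun=> A (m.+1 %/ 2))) => [|k _]; last by case: ifP.
  by rewrite sumr_const card_ord -mulr_natl; field.
rewrite sum_parity // divn2.
have -> : m%:R = 2 * (m./2)%:R :> rat by rewrite -{1}(even_halfK om) -muln2 natrM mulrC.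
have : (0 < m./2)%N by [].
case: (m./2) => // q _; rewrite subn1 [q.+1.-1]/= !exprS -[LHS]mulr_natl.
by field.
Qed.

End CyclicModel.

(** * The orbit count from the rotation and reflection sums *)

Theorem theorem6p4 (R : realType) (m : nat) (hm : (2 <= m)%N) :
  #|double_coset R m|%:R =
    (2 * m%:R)^-1 *
      (\sum_(d <- divisors m)
          (totient (m %/ d))%:R *
            (6^-1 * (alpha (gcdn (m %/ d) 6) * A d
                     + beta (gcdn (m %/ d) 6) * A (d - 1)))
       + E m) :> rat.
Proof.
case: m hm => [|[|p]] // _; set m := p.+2.
pose f d := alpha (gcdn (m %/ d) 6) * A d + beta (gcdn (m %/ d) 6) * A (d - 1).
have rotE : \sum_(k < m) \sum_(a : {'GL_2['F_2]}) #|fixed_colorings a k false|%:R =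
    \sum_(d <- divisors m) (totient (m %/ d))%:R * f d.
  rewrite (eq_bigr (fun k : 'I_m => f (gcdn k m))) => [|k _]; last exact: sum_rotation.
  by rewrite sum_gcdn //; apply: eq_bigr => d _; rewrite mulr_natl.
have m0 : m%:R != 0 :> rat by rewrite pnatr_eq0.
have := congr1 (fun n => n%:R : rat) (burnside p R).
rewrite exchange_big /= !natrM natr_sum.
under eq_bigr => k _.
  rewrite natr_sum; under eq_bigr do rewrite big_bool natrD; rewrite big_split /=; over.
rewrite big_split /= [X in X + _]sum_reflections [X in _ + X]rotE => burn.
have -> : \sum_(d <- divisors m) (totient (m %/ d))%:R * (6^-1 * f d) =
    6^-1 * \sum_(d <- divisors m) (totient (m %/ d))%:R * f d.
  by rewrite mulr_sumr; apply: eq_bigr => d _; rewrite mulrCA.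
(* Multiplying by 12 m, the factor in the orbit count, reduces the goal to [burn]. *)
apply: (mulIf (_ : 6 * (2 * m%:R) != 0)); first by rewrite !mulf_neq0.
by rewrite burn; field.
Qed.
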